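(* For all integers $p\ge2$ and $m\ge1$, let $I_p=\sum_{k=1}^{p-1}\frac{1}{\sin(k\pi/p)}$. Then there is a real number $\varepsilon'_{p,m}$ with $0<\varepsilon'_{p,m}<|b_{2m}|$ such that $$\pi I_p=2p\ln p+2\left(\gamma-\ln(\pi/2)\right)p-\sum_{k=1}^{m-1}\frac{2b_{2k}\,\eta(2k)}{k\cdot p^{2k-1}}+(-1)^m\frac{2\eta(2m)}{m\cdot p^{2m-1}}\,\varepsilon'_{p,m}.$$
   Context: The Bernoulli polynomials $(B_n)_{n\ge 0}$ are the unique sequence of real polynomials with $B_0(X)=1$ and, for all $n\ge1$, $B_n(X+1)-B_n(X)=nX^{n-1}$ and $\int_0^1B_n(t)\,dt=0$; the Bernoulli numbers are $b_n=B_n(0)$. For $k\ge1$, $\eta(2k)=\sum_{j=1}^\infty\frac{(-1)^{j-1}}{j^{2k}}$. $\gamma$ is the Euler–Mascheroni constant. Empty sums are $0$. *)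

(* Defs.v *)
From Stdlib Require Import Reals Lra Lia.
From Coquelicot Require Import Coquelicot.
Open Scope R_scope.

Definition is_polynomial (f : R -> R) : Prop :=
  exists (d : nat) (a : nat -> R),
    forall x, f x = sum_n (fun i => a i * x ^ i) d.

(* Real polynomials are identified with the functions they induce on R;
   [B n] is the n-th Bernoulli polynomial. *)
Definition is_bernoulli_sequence (B : nat -> R -> R) : Prop :=
  (forall n, is_polynomial (B n)) /\
  (forall x, B 0%nat x = 1) /\
  (forall n, (1 <= n)%nat ->
     (forall x, B n (x + 1) - B n x = INR n * x ^ (n - 1)) /\
     is_RInt (B n) 0 1 0).

Definition eta (s : nat) : R :=
  Series (fun j => (-1) ^ j / INR (j + 1) ^ s).

Definition euler_gamma : R :=
  real (Lim_seq (fun n => sum_n_m (fun k => / INR k) 1 n - ln (INR n))).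

Definition cosecant_sum (p : nat) : R :=
  sum_n_m (fun k => 1 / sin (INR k * PI / INR p)) 1 (p - 1).

(* Existence, so that [is_bernoulli_sequence] is not a vacuous hypothesis. *)

Lemma is_polynomial_cont f : is_polynomial f -> forall x, continuous f x.
Proof.
  intros (d & a & H) x.
  apply (continuous_ext (fun y => sum_n (fun i => a i * y ^ i) d)).
  { intros y; symmetry; apply H. }
  clear H; induction d as [|d IH].
  - apply (continuous_ext (fun _ => a 0%nat)).
    { intros y; rewrite sum_O; simpl; ring. }
    apply continuous_const.
  - apply (continuous_ext
      (fun y => plus (sum_n (fun i => a i * y ^ i) d) (a (S d) * y ^ S d))).
    { intros y; rewrite sum_Sn; reflexivity. }
    apply (continuous_plus (V := R_NormedModule)); [exact IH|].
    apply (ex_derive_continuous (V := R_NormedModule)); auto_derive; auto.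
Qed.

Lemma is_polynomial_antiderivative f : is_polynomial f ->
  forall c, exists F, is_polynomial F /\ F 0 = c /\ forall x, is_derive F x (f x).
Proof.
  intros (d & a & H) c.
  pose (a' := fun i => match i with O => c | S j => a j / INR (S j) end).
  exists (fun x => sum_n (fun i => a' i * x ^ i) (S d)).
  split; [exists (S d), a'; reflexivity|].
  split.
  - clear H; induction d as [|d IH].
    + rewrite sum_Sn, sum_O; unfold plus; simpl; ring.
    + rewrite sum_Sn, IH; unfold plus; simpl; ring.
  - intros x; rewrite H; clear H; induction d as [|d IH].
    + apply (is_derive_ext (fun y => c + a 0%nat * y)).
      { intros y; rewrite sum_Sn, sum_O; unfold plus, a'; simpl; field. }
      rewrite sum_O; auto_derive; auto; simpl; ring.
    + rewrite sum_Sn.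
      apply (is_derive_ext (fun y =>
        plus (sum_n (fun i => a' i * y ^ i) (S d)) (a' (S (S d)) * y ^ S (S d)))).
      { intros y; rewrite (sum_Sn _ (S d)); reflexivity. }
      apply (is_derive_plus (V := R_NormedModule)); [exact IH|].
      replace (a (S d) * x ^ S d)
        with (a' (S (S d)) * (INR (S (S d)) * x ^ S d))
        by (unfold a'; field; apply not_0_INR; lia).
      generalize (a' (S (S d))); intros k.
      auto_derive; auto; simpl; ring.
Qed.

Lemma is_polynomial_affine f c k :
  is_polynomial f -> is_polynomial (fun x => k * f x + c).
Proof.
  intros (d & a & H).
  exists d, (fun i => k * a i + match i with O => c | _ => 0 end).
  intros x; rewrite H; clear H; induction d as [|d IH].
  - rewrite !sum_O; simpl; ring.
  - rewrite !sum_Sn, <- IH; unfold plus; simpl; ring.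
Qed.

Lemma is_polynomial_ext f g :
  (forall x, f x = g x) -> is_polynomial f -> is_polynomial g.
Proof.
  intros E (d & a & H); exists d, a; intros x; rewrite <- E; apply H.
Qed.

Lemma is_polynomial_ex_RInt f a b : is_polynomial f -> ex_RInt f a b.
Proof.
  intros H; apply (ex_RInt_continuous (V := R_CompleteNormedModule)); intros x _.
  now apply is_polynomial_cont.
Qed.

Lemma is_polynomial_RInt f :
  is_polynomial f -> is_polynomial (fun x => RInt f 0 x).
Proof.
  intros Pf; destruct (is_polynomial_antiderivative f Pf 0) as (F & PF & F0 & DF).
  apply (is_polynomial_ext F); [|exact PF].
  intros x; symmetry; apply is_RInt_unique.
  replace (F x) with (minus (F x) (F 0))
    by (rewrite F0; unfold minus, plus, opp; simpl; ring).
  apply (is_RInt_derive (V := R_CompleteNormedModule)); intros y _.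
  - apply DF.
  - now apply is_polynomial_cont.
Qed.

Fixpoint bernoulli_rec (n : nat) : R -> R :=
  match n with
  | O => fun _ => 1
  | S m => fun x => INR (S m) * RInt (bernoulli_rec m) 0 x +
                    - RInt (fun y => INR (S m) * RInt (bernoulli_rec m) 0 y) 0 1
  end.

Lemma bernoulli_rec_polynomial n : is_polynomial (bernoulli_rec n).
Proof.
  induction n as [|n IH].
  - exists 0%nat, (fun _ => 1); intros x; rewrite sum_O; simpl; ring.
  - apply is_polynomial_affine, is_polynomial_RInt, IH.
Qed.

Lemma bernoulli_rec_derive n x :
  is_derive (bernoulli_rec (S n)) x (INR (S n) * bernoulli_rec n x).
Proof.
  assert (D : is_derive (fun y => RInt (bernoulli_rec n) 0 y) x (bernoulli_rec n x)).
  { apply (is_derive_RInt (V := R_CompleteNormedModule)) with 0.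
    - apply filter_forall; intros y; apply (RInt_correct (V := R_CompleteNormedModule)).
      apply is_polynomial_ex_RInt, bernoulli_rec_polynomial.
    - apply is_polynomial_cont, bernoulli_rec_polynomial. }
  cbn [bernoulli_rec]; set (k := INR (S n)); set (c := - _).
  replace (k * bernoulli_rec n x) with (plus (k * bernoulli_rec n x) zero)
    by (unfold plus, zero; simpl; ring).
  apply (is_derive_plus (V := R_NormedModule)).
  - apply (is_derive_scal (fun y => RInt (bernoulli_rec n) 0 y)); exact D.
  - apply (is_derive_const (V := R_NormedModule)).
Qed.

Lemma bernoulli_rec_mean n : is_RInt (bernoulli_rec (S n)) 0 1 0.
Proof.
  cbn [bernoulli_rec]; set (F := fun y => INR (S n) * RInt (bernoulli_rec n) 0 y); set (I := RInt F 0 1).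
  replace 0 with (plus I (scal (1 - 0) (- I))) at 2
    by (unfold plus, scal; simpl; unfold mult; simpl; ring).
  apply (is_RInt_plus (V := R_NormedModule)).
  - apply (RInt_correct (V := R_CompleteNormedModule)), is_polynomial_ex_RInt.
    apply (is_polynomial_ext (fun x => INR (S n) * RInt (bernoulli_rec n) 0 x + 0)).
    { intros x; unfold F; ring. }
    apply is_polynomial_affine, is_polynomial_RInt, bernoulli_rec_polynomial.
  - apply (is_RInt_const (V := R_NormedModule)).
Qed.

Lemma bernoulli_rec_difference n x :
  bernoulli_rec (S n) (x + 1) - bernoulli_rec (S n) x = INR (S n) * x ^ n.
Proof.
  revert x; induction n as [|n IH]; intros x.
  - cbn [bernoulli_rec]; rewrite !RInt_const.
    unfold scal; simpl; unfold mult; simpl; ring.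
  - set (G := fun y => bernoulli_rec (S (S n)) (y + 1) - bernoulli_rec (S (S n)) y
                       - INR (S (S n)) * y ^ S n).
    assert (DG : forall y, is_derive G y 0).
    { intros y; unfold G.
      set (P := bernoulli_rec (S (S n))).
      assert (D1 : is_derive (fun y => P (y + 1)) y
                     (INR (S (S n)) * bernoulli_rec (S n) (y + 1))).
      { replace (INR (S (S n)) * bernoulli_rec (S n) (y + 1))
          with (scal 1 (INR (S (S n)) * bernoulli_rec (S n) (y + 1)))
          by (unfold scal; simpl; unfold mult; simpl; ring).
        apply (is_derive_comp (V := R_NormedModule) P (fun y => y + 1)).
        - apply bernoulli_rec_derive.
        - auto_derive; auto. }
      assert (D2 := bernoulli_rec_derive (S n) y); fold P in D2.
      assert (D3 : is_derive (fun y => INR (S (S n)) * y ^ S n) y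
                     (INR (S (S n)) * (INR (S n) * y ^ n))).
      { auto_derive; auto; simpl; ring. }
      assert (D := is_derive_minus (V := R_NormedModule) _ _ _ _ _
                     (is_derive_minus (V := R_NormedModule) _ _ _ _ _ D1 D2) D3).
      match type of D with is_derive _ _ ?l => replace 0 with l end.
      - exact D.
      - specialize (IH y); unfold minus, plus, opp; simpl plus.
        change (INR (S (S n)) * bernoulli_rec (S n) (y + 1)
                + - (INR (S (S n)) * bernoulli_rec (S n) y)
                + - (INR (S (S n)) * (INR (S n) * y ^ n)) = 0).
        rewrite <- IH; ring. }
    assert (G0 : G 0 = 0).
    { unfold G; rewrite Rplus_0_l.
      assert (E : is_RInt (fun y => INR (S (S n)) * bernoulli_rec (S n) y) 0 1
               (minus (bernoulli_rec (S (S n)) 1) (bernoulli_rec (S (S n)) 0))).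
      { apply (is_RInt_derive (V := R_CompleteNormedModule)); intros y _.
        - apply bernoulli_rec_derive.
        - apply (continuous_scal_r (V := R_NormedModule) (INR (S (S n)))
                   (bernoulli_rec (S n))).
          apply is_polynomial_cont, bernoulli_rec_polynomial. }
      assert (E' := is_RInt_scal (V := R_NormedModule) _ _ _ (INR (S (S n))) _
                      (bernoulli_rec_mean n)).
      apply (is_RInt_unique (V := R_CompleteNormedModule)) in E; apply (is_RInt_unique (V := R_CompleteNormedModule)) in E'.
      assert (Q : bernoulli_rec (S (S n)) 1 - bernoulli_rec (S (S n)) 0
                  = INR (S (S n)) * 0) by exact (eq_trans (eq_sym E) E').
      rewrite Q; simpl; ring. }
    assert (Gx : G x = G 0).
    { destruct (MVT_gen G 0 x (fun _ => 0)) as (c & _ & E).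
      - intros; apply DG.
      - intros y _; apply continuity_pt_filterlim.
        apply (ex_derive_continuous (V := R_NormedModule)); exists 0; apply DG.
      - lra. }
    rewrite G0 in Gx; unfold G in Gx; lra.
Qed.

Theorem is_bernoulli_sequence_exists : exists B, is_bernoulli_sequence B.
Proof.
  exists bernoulli_rec; split; [exact bernoulli_rec_polynomial|split].
  - reflexivity.
  - intros [|n] Hn; [lia|]; split; [|apply bernoulli_rec_mean].
    intros x; rewrite bernoulli_rec_difference.
    simpl Nat.sub; rewrite Nat.sub_0_r; reflexivity.
Qed.

(* Main.v *)
(* Partial fractions of [PI / sin (PI x)] turn [PI * cosecant_sum p] into
   [2 p] times the alternating sum over j of the harmonic blocks
   [H((j+1)p - 1) - H(jp)]. Summing by parts and inserting Euler-Maclaurin,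
   [H(n) = ln n + euler_gamma + 1/(2n) - sum_(k<m) b_(2k)/(2k n^(2k)) +- r_m(n)],
   the terms [ln j] produce Wallis' product, hence [- ln (PI/2)], and the
   powers of [1/n] produce the values [eta (2k)]. The remainder [r_m] is
   strictly decreasing with limit 0, because [r_m(n) - r_m(n+1)] is the increment of
   a function whose derivative has the constant sign of
   [(-1)^m (B_(2m)(t) - b_(2m))] on (0, 1). So the alternating sum of
   [r_m(jp)] is positive; applied to [m] and [m + 1] this gives both bounds on eps. *)

Require Import Defs.
From Stdlib Require Import Reals Lra Lia.
From Coquelicot Require Import Coquelicot.
Open Scope R_scope.

(** * Bernoulli polynomials *)

Lemma is_derive_0_const (f : R -> R) :
  (forall x, is_derive f x 0) -> forall x y, f x = f y.
Proof.
  intros D x y; destruct (Rtotal_order x y) as [H|[->|H]]; [|reflexivity|symmetry];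
    apply (eq_is_derive (V := R_NormedModule)); auto; intros; apply D.
Qed.

Lemma mean_value (f df : R -> R) a b : a < b ->
  (forall x, a <= x <= b -> is_derive f x (df x)) ->
  exists c, a < c < b /\ f b - f a = df c * (b - a).
Proof.
  intros Hab D.
  destruct (MVT_cor2 f df a b Hab) as (c & E & Hc).
  { intros c Hc; apply is_derive_Reals, D, Hc. }
  exists c; split; [exact Hc|exact E].
Qed.

Lemma sum_pow_derive (a : nat -> R) d x :
  is_derive (fun y => sum_n (fun i => a i * y ^ i) (S d)) x
    (sum_n (fun i => INR (S i) * a (S i) * x ^ i) d).
Proof.
  induction d as [|d IH].
  - apply (is_derive_ext (fun y => a 0%nat + a 1%nat * y)).
    { intros y; rewrite sum_Sn, sum_O; unfold plus; simpl; ring. }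
    rewrite sum_O; auto_derive; auto; simpl; ring.
  - rewrite sum_Sn.
    apply (is_derive_ext (fun y =>
      plus (sum_n (fun i => a i * y ^ i) (S d)) (a (S (S d)) * y ^ S (S d)))).
    { intros y; rewrite (sum_Sn _ (S d)); reflexivity. }
    apply (is_derive_plus (V := R_NormedModule)); [exact IH|].
    generalize (a (S (S d))); intros k.
    auto_derive; auto; simpl; ring.
Qed.

(** Induction on the degree bound: the derivative is periodic of lower degree, hence constant. Since
    [f 1 = f 0], the mean value theorem makes that constant 0. *)
Lemma periodic_polynomial_const d (a : nat -> R) :
  let f x := sum_n (fun i => a i * x ^ i) d in
  (forall x, f (x + 1) = f x) -> forall x y, f x = f y.
Proof.
  revert a; induction d as [|d IH]; intros a f Pf.
  { intros x y; unfold f; rewrite !sum_O; reflexivity. }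
  set (g x := sum_n (fun i => INR (S i) * a (S i) * x ^ i) d).
  assert (D : forall x, is_derive f x (g x)) by (intros; apply sum_pow_derive).
  assert (Pg : forall x, g (x + 1) = g x).
  { intros x; rewrite <- (is_derive_unique _ _ _ (D x)).
    symmetry; apply is_derive_unique.
    apply (is_derive_ext (fun y => f (y + 1))); [exact Pf|].
    replace (g (x + 1)) with (scal 1 (g (x + 1)))
      by (unfold scal; simpl; unfold mult; simpl; ring).
    apply (is_derive_comp (V := R_NormedModule) f (fun y => y + 1));
      [apply D|auto_derive; auto]. }
  assert (G : forall x y, g x = g y) by exact (IH _ Pg).
  assert (G0 : g 0 = 0).
  { destruct (mean_value f g 0 1) as (c & _ & E); [lra|intros; apply D|].
    rewrite (G 0 c); specialize (Pf 0); rewrite Rplus_0_l in Pf; lra. }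
  apply is_derive_0_const; intros x.
  assert (Gx := D x); rewrite (G x 0), G0 in Gx; exact Gx.
Qed.

Lemma is_polynomial_plus f g :
  is_polynomial f -> is_polynomial g -> is_polynomial (fun x => f x + g x).
Proof.
  intros (d & a & Hf) (e & c & Hg).
  (* Padding with zero coefficients writes both polynomials with the common degree bound [d + e]. *)
  set (cut n (u : nat -> R) i := if Nat.leb i n then u i else 0).
  assert (L : forall n u k x,
    sum_n (fun i => cut n u i * x ^ i) (n + k) = sum_n (fun i => u i * x ^ i) n).
  { intros n u k x; induction k as [|k IHk].
    - rewrite Nat.add_0_r; apply sum_n_ext_loc; intros i Hi; unfold cut.
      now rewrite (proj2 (Nat.leb_le i n) Hi).
    - rewrite Nat.add_succ_r, sum_Sn, IHk; unfold cut.
      rewrite (proj2 (Nat.leb_gt (S (n + k)) n)) by lia.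
      unfold plus; simpl; ring. }
  exists (d + e)%nat, (fun i => cut d a i + cut e c i); intros x.
  rewrite Hf, Hg, <- (L d a e x), <- (L e c d x), (Nat.add_comm e d).
  symmetry; etransitivity; [|apply (sum_n_plus (G := R_AbelianMonoid))].
  apply sum_n_ext; intros i; unfold plus; simpl; ring.
Qed.

(** The difference of two solutions is a 1-periodic polynomial, hence constant, and its mean over
    [0, 1] is 0. From here on [bernoulli_rec], whose derivative is known, can replace [B]. *)
Lemma bernoulli_sequence_unique B : is_bernoulli_sequence B ->
  forall n x, B n x = bernoulli_rec n x.
Proof.
  intros (PB & B0 & BS) [|n] x; [apply B0|].
  destruct (BS (S n)) as [BD BI]; [lia|].
  set (f := fun x => B (S n) x + (-1 * bernoulli_rec (S n) x + 0)).
  assert (Pf : is_polynomial f)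
    by (apply is_polynomial_plus, is_polynomial_affine, bernoulli_rec_polynomial; apply PB).
  assert (C : forall x y, f x = f y).
  { destruct Pf as (d & a & Ef); intros u v; rewrite !Ef.
    apply (periodic_polynomial_const d a); intros y; rewrite <- !Ef; unfold f.
    assert (E := bernoulli_rec_difference n y); specialize (BD y).
    replace (S n - 1)%nat with n in BD by lia; lra. }
  assert (I : is_RInt f 0 1 0).
  { assert (J := is_RInt_minus (V := R_NormedModule) _ _ _ _ _ _ BI (bernoulli_rec_mean n)).
    replace 0 with (minus 0 0) at 2 by (unfold minus, plus, opp; simpl; ring).
    eapply is_RInt_ext; [|exact J].
    intros y _; change (B (S n) y + - bernoulli_rec (S n) y
                        = B (S n) y + (-1 * bernoulli_rec (S n) y + 0)); ring. }
  assert (I' : is_RInt f 0 1 (scal (1 - 0) (f x))).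
  { apply (is_RInt_ext (fun _ => f x)); [intros; apply C|].
    apply (is_RInt_const (V := R_NormedModule)). }
  apply (is_RInt_unique (V := R_CompleteNormedModule)) in I.
  apply (is_RInt_unique (V := R_CompleteNormedModule)) in I'.
  rewrite I in I'; unfold scal in I'; simpl in I'; unfold mult in I'; simpl in I'.
  unfold f in I'; simpl in I' |- *; lra.
Qed.

(** * Symmetry and signs of the Bernoulli polynomials *)

Notation bern := bernoulli_rec.

(** By the induction hypothesis the difference of the two sides has derivative 0; being constant
    with mean 0 on [0, 1], it vanishes. *)
Lemma bern_reflection n x : bern n (1 - x) = (-1) ^ n * bern n x.
Proof.
  revert x; induction n as [|n IH]; intros x; [simpl; ring|].
  set (f := fun x => bern (S n) (1 - x) - (-1) ^ S n * bern (S n) x).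
  assert (D : forall y, is_derive f y 0).
  { intros y; unfold f.
    replace 0 with (minus (scal (-1) (INR (S n) * bern n (1 - y)))
                      ((-1) ^ S n * (INR (S n) * bern n y))).
    2: { rewrite IH; change (-1 * (INR (S n) * ((-1) ^ n * bern n y))
           + - (-1 * (-1) ^ n * (INR (S n) * bern n y)) = 0); ring. }
    apply (is_derive_minus (V := R_NormedModule)).
    - apply (is_derive_comp (V := R_NormedModule) (bern (S n)) (fun y => 1 - y));
        [apply bernoulli_rec_derive|auto_derive; auto; ring].
    - apply (is_derive_scal (bern (S n))), bernoulli_rec_derive. }
  assert (C := is_derive_0_const f D).
  assert (I1 : is_RInt (fun y => bern (S n) (1 - y)) 0 1 0).
  { assert (J' : is_RInt (bern (S n)) (-1 * 0 + 1) (-1 * 1 + 1) (opp 0)).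
    { replace (-1 * 0 + 1) with 1 by ring; replace (-1 * 1 + 1) with 0 by ring.
      apply (is_RInt_swap (V := R_NormedModule)), bernoulli_rec_mean. }
    apply (is_RInt_comp_lin (V := R_NormedModule)) in J'.
    apply (is_RInt_scal (V := R_NormedModule) _ _ _ (-1)) in J'.
    replace 0 with (scal (-1) (opp 0)) at 2
      by (unfold scal, opp; simpl; unfold mult; simpl; ring).
    eapply is_RInt_ext; [|exact J'].
    intros y _; cbv beta; replace (-1 * y + 1) with (1 - y) by ring.
    change (-1 * (-1 * bern (S n) (1 - y)) = bern (S n) (1 - y)); ring. }
  assert (I : is_RInt f 0 1 (minus 0 (scal ((-1) ^ S n) 0))).
  { apply (is_RInt_minus (V := R_NormedModule)); [exact I1|].
    apply (is_RInt_scal (V := R_NormedModule)), bernoulli_rec_mean. }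
  assert (I' : is_RInt f 0 1 (scal (1 - 0) (f x))).
  { apply (is_RInt_ext (fun _ => f x)); [intros; apply C|].
    apply (is_RInt_const (V := R_NormedModule)). }
  apply (is_RInt_unique (V := R_CompleteNormedModule)) in I.
  apply (is_RInt_unique (V := R_CompleteNormedModule)) in I'.
  assert (F : f x = 0).
  { rewrite I in I'; unfold minus, plus, opp, scal in I'; simpl in I'.
    unfold mult in I'; simpl in I'; lra. }
  unfold f in F; lra.
Qed.

Lemma bern_at_1 n : bern (S (S n)) 1 = bern (S (S n)) 0.
Proof.
  assert (E := bernoulli_rec_difference (S n) 0).
  rewrite Rplus_0_l, pow_i in E by lia; lra.
Qed.

Lemma pow_m1_even m : (-1) ^ (2 * m) = 1.
Proof. rewrite pow_mult; replace ((-1) ^ 2) with 1 by ring; apply pow1. Qed.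

(** Reflection gives opposite values at 0 and 1, while [bern_at_1] gives equal ones. The index
    starts at 3 because the value of [bern 1] at 0 is - 1/2. *)
Lemma bern_odd_0 m : bern (2 * m + 3) 0 = 0.
Proof.
  assert (E := bern_reflection (2 * m + 3) 0); assert (E1 := bern_at_1 (2 * m + 1)).
  replace (S (S (2 * m + 1))) with (2 * m + 3)%nat in E1 by lia.
  rewrite Rminus_0_r, E1, pow_add, pow_m1_even in E.
  change ((-1) ^ 3) with (-1 * (-1 * (-1 * 1))) in E; lra.
Qed.

Lemma bern_odd_half m : bern (2 * m + 1) (1 / 2) = 0.
Proof.
  assert (E := bern_reflection (2 * m + 1) (1 / 2)).
  replace (1 - 1 / 2) with (1 / 2) in E by lra.
  rewrite pow_add, pow_m1_even, pow_1 in E; lra.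
Qed.

Lemma bern_1 x : bern 1 x = x - 1 / 2.
Proof.
  assert (E : forall y z, bern 1 y - y = bern 1 z - z).
  { apply is_derive_0_const; intros y.
    replace 0 with (minus (INR 1 * bern 0 y) 1)
      by (unfold minus, plus, opp; simpl; ring).
    apply (is_derive_minus (V := R_NormedModule)); [apply bernoulli_rec_derive|].
    apply (is_derive_id (K := R_AbsRing)). }
  assert (H := bern_odd_half 0); specialize (E x (1 / 2)).
  simpl (2 * 0 + 1)%nat in H; lra.
Qed.

(** The derivative is a positive multiple of the odd polynomial below. Its sign is a hypothesis so
    that this lemma can be used inside the induction that establishes the sign. *)
Lemma bern_even_lower_half m :
  (forall x, 0 < x < 1 / 2 -> 0 < (-1) ^ S m * bern (2 * m + 1) x) ->
  forall x y, 0 <= x -> x < y -> y <= 1 / 2 ->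
    (-1) ^ S m * bern (2 * m + 2) x < (-1) ^ S m * bern (2 * m + 2) y.
Proof.
  intros H x y Hx Hxy Hy.
  destruct (mean_value (fun t => (-1) ^ S m * bern (2 * m + 2) t)
    (fun t => (-1) ^ S m * (INR (2 * m + 2) * bern (2 * m + 1) t)) x y Hxy) as (c & Hc & E).
  { intros t _; apply (is_derive_scal (bern (2 * m + 2))).
    replace (2 * m + 2)%nat with (S (2 * m + 1)) by lia; apply bernoulli_rec_derive. }
  assert (P : 0 < INR (2 * m + 2)) by (apply lt_0_INR; lia).
  assert (Q := H c ltac:(lra)).
  assert (0 < INR (2 * m + 2) * ((-1) ^ S m * bern (2 * m + 1) c) * (y - x))
    by (apply Rmult_lt_0_compat; [apply Rmult_lt_0_compat|]; lra).
  lra.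
Qed.

(* On [0, 1/2] the next odd polynomial vanishes at both ends and, up to sign,
   has strictly decreasing derivative. *)
Lemma bern_odd_sign m x :
  0 < x < 1 / 2 -> 0 < (-1) ^ S m * bern (2 * m + 1) x.
Proof.
  revert x; induction m as [|m IH]; intros x Hx.
  { simpl (2 * 0 + 1)%nat; rewrite bern_1; simpl; lra. }
  assert (M := bern_even_lower_half m IH).
  assert (D : forall t, is_derive (fun t => (-1) ^ S m * bern (2 * m + 3) t) t
                ((-1) ^ S m * (INR (2 * m + 3) * bern (2 * m + 2) t))).
  { intros t; apply (is_derive_scal (bern (2 * m + 3))).
    replace (2 * m + 3)%nat with (S (2 * m + 2)) by lia; apply bernoulli_rec_derive. }
  destruct (mean_value _ _ 0 x (proj1 Hx) (fun t _ => D t)) as (c1 & H1 & E1).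
  destruct (mean_value _ _ x (1 / 2) (proj2 Hx) (fun t _ => D t)) as (c2 & H2 & E2).
  cbv beta in E1, E2; rewrite bern_odd_0 in E1.
  assert (Eh := bern_odd_half (S m)).
  replace (2 * S m + 1)%nat with (2 * m + 3)%nat in * by lia; rewrite Eh in E2.
  assert (Mc := M c1 c2 ltac:(lra) ltac:(lra) ltac:(lra)).
  assert (P : 0 < INR (2 * m + 3)) by (apply lt_0_INR; lia).
  change ((-1) ^ S (S m)) with (-1 * (-1) ^ S m).
  set (s := (-1) ^ S m) in *; set (k := INR (2 * m + 3)) in *.
  set (b1 := s * bern (2 * m + 2) c1) in *; set (b2 := s * bern (2 * m + 2) c2) in *.
  replace (s * (k * bern (2 * m + 2) c1)) with (k * b1) in E1 by (unfold b1; ring).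
  replace (s * (k * bern (2 * m + 2) c2)) with (k * b2) in E2 by (unfold b2; ring).
  set (v := s * bern (2 * m + 3) x) in *.
  replace (-1 * s * bern (2 * m + 3) x) with (- v) by (unfold v; ring).
  (* If [v >= 0], rising from 0 to [v] forces [b1 >= 0], and returning to 0 at 1/2 forces [b2 <= 0],
     against [b1 < b2]. *)
  destruct (Rlt_le_dec 0 (- v)) as [|Hv]; [assumption|exfalso].
  assert (A1 : 0 <= k * b1) by (destruct (Rle_lt_dec 0 (k * b1)); [assumption|nra]).
  assert (A2 : k * b2 <= 0) by (destruct (Rle_lt_dec (k * b2) 0); [assumption|nra]).
  nra.
Qed.

(** Monotonicity on [0, 1/2] settles the lower half; reflection carries it to the upper half. *)
Lemma bern_even_sign m t : 0 < t < 1 ->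
  0 < (-1) ^ S m * (bern (2 * m + 2) t - bern (2 * m + 2) 0).
Proof.
  assert (M := bern_even_lower_half m (bern_odd_sign m)).
  intros Ht; destruct (Rle_lt_dec t (1 / 2)) as [H|H].
  - assert (E := M 0 t); lra.
  - assert (E := M 0 (1 - t)); rewrite bern_reflection in E.
    replace (2 * m + 2)%nat with (2 * S m)%nat in * by lia.
    rewrite pow_m1_even in E; lra.
Qed.

(** * Euler-Maclaurin remainders *)

Lemma is_derive_div_pow (u : R -> R) du x t k : 0 < x + t -> is_derive u t du ->
  is_derive (fun t => u t / (x + t) ^ S k) t
    (du / (x + t) ^ S k - INR (S k) * u t / (x + t) ^ S (S k)).
Proof.
  intros Hx Du.
  assert (P : forall j, (x + t) ^ j <> 0) by (intros; apply pow_nonzero; lra).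
  evar_last.
  - apply (is_derive_div u (fun t => (x + t) ^ S k)); [exact Du| |apply P].
    auto_derive; [auto|reflexivity].
  - change (pred (S k)) with k; unfold minus, plus, opp, scal; simpl.
    assert (H := P k); field; split; [exact H|lra].
Qed.

(** Level 0 is the error of the trapezoidal rule for 1/t on [x, x + 1]. Subtracting the previous
    level flips the sign each time, which keeps every level positive. *)
Fixpoint em_step (m : nat) (x : R) : R :=
  match m with
  | O => (/ (x + 1) + / x) / 2 - (ln (x + 1) - ln x)
  | S k => (-1) ^ k * bern (2 * k + 2) 0 / INR (2 * k + 2)
           * (/ x ^ (2 * k + 2) - / (x + 1) ^ (2 * k + 2)) - em_step k x
  end.

(* Integrating by parts twice turns the Euler-Maclaurin remainder integrand of
   order [m + 1] into the one of order [m]. *)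
Lemma em_step_antiderivative m x : 0 < x -> exists F : R -> R,
  (forall t, 0 <= t <= 1 -> is_derive F t
     ((-1) ^ S m * (bern (2 * m + 2) t - bern (2 * m + 2) 0) / (x + t) ^ (2 * m + 3)))
  /\ F 1 - F 0 = em_step m x.
Proof.
  intros Hx.
  assert (D : forall n t c k, 0 <= t -> is_derive (fun t => (bern (S n) t - c) / (x + t) ^ S k) t
    (INR (S n) * bern n t / (x + t) ^ S k
     - INR (S k) * (bern (S n) t - c) / (x + t) ^ S (S k))).
  { intros n t c k Ht.
    apply (is_derive_div_pow (fun t => bern (S n) t - c)); [lra|].
    replace (INR (S n) * bern n t) with (minus (INR (S n) * bern n t) 0)
      by exact (Rminus_0_r _).
    apply (is_derive_minus (V := R_NormedModule) (bern (S n)) (fun _ => c));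
      [apply bernoulli_rec_derive|apply (is_derive_const (V := R_NormedModule))]. }
  assert (D1 : forall t k, 0 <= t -> is_derive (fun t => 1 / (x + t) ^ S k) t
    (0 / (x + t) ^ S k - INR (S k) * 1 / (x + t) ^ S (S k))).
  { intros t k Ht; apply (is_derive_div_pow (fun _ => 1)); [lra|].
    apply (is_derive_const (V := R_NormedModule)). }
  induction m as [|m (F & DF & EF)].
  (* Two integrations by parts of [- (bern 2 t - bern 2 0) / (x + t) ^ 3]: the boundary terms carry
     [bern 2] and [bern 1], and 1/(x + t) is left to integrate. *)
  - exists (fun t => / 2 * ((bern 2 t - bern 2 0) / (x + t) ^ 2)
                     + ((bern 1 t - 0) / (x + t) ^ 1 - ln (x + t))).
    split.
    + intros t Ht; evar_last.
      * apply (is_derive_plus (V := R_NormedModule)).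
        -- apply (is_derive_scal (fun t => (bern 2 t - bern 2 0) / (x + t) ^ 2)).
           apply (D 1%nat t _ 1%nat); lra.
        -- apply (is_derive_minus (V := R_NormedModule)).
           ++ apply (D 0%nat t _ 0%nat); lra.
           ++ auto_derive; [lra|reflexivity].
      * change (2 * 0 + 2)%nat with 2%nat; change (2 * 0 + 3)%nat with 3%nat.
        set (b2 := bern 2 t); set (b20 := bern 2 0); set (b1 := bern 1 t).
        change (bern 0 t) with 1; clearbody b2 b20 b1; clear -Hx Ht.
        unfold minus, plus, opp; simpl; field; lra.
    + rewrite bern_at_1, !bern_1; simpl em_step; rewrite Rplus_0_r.
      field; lra.
  - set (s := (-1) ^ m); remember (2 * m)%nat as n eqn:En.
    (* The middle summands are the boundary terms of the two integrations by parts. The last one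
       integrates the constant [bern (n + 2) 0] that the integrand of order [m] subtracts. *)
    exists (fun t => - F t
             + (- s / INR (n + 4)) * ((bern (n + 4) t - bern (n + 4) 0) / (x + t) ^ (n + 4))
             + (- s / INR (n + 3)) * ((bern (n + 3) t - 0) / (x + t) ^ (n + 3))
             + (- s * bern (n + 2) 0 / INR (n + 2)) * (1 / (x + t) ^ (n + 2))).
    assert (I : forall k, (0 < k)%nat -> INR k <> 0) by (intros; apply not_0_INR; lia).
    replace (2 * S m)%nat with (n + 2)%nat by lia.
    split.
    + intros t Ht; evar_last.
      * apply (is_derive_plus (V := R_NormedModule)); [apply (is_derive_plus (V := R_NormedModule));
          [apply (is_derive_plus (V := R_NormedModule))|]|].
        -- apply (is_derive_opp (V := R_NormedModule)), DF, Ht.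
        -- apply (is_derive_scal (fun t => (bern (n + 4) t - bern (n + 4) 0) / (x + t) ^ (n + 4))).
           replace (n + 4)%nat with (S (n + 3)) by lia; apply (D (n + 3)%nat); lra.
        -- apply (is_derive_scal (fun t => (bern (n + 3) t - 0) / (x + t) ^ (n + 3))).
           replace (n + 3)%nat with (S (n + 2)) by lia; apply (D (n + 2)%nat); lra.
        -- apply (is_derive_scal (fun t => 1 / (x + t) ^ (n + 2))).
           replace (n + 2)%nat with (S (n + 1)) by lia; apply D1; lra.
      * assert (E1 : (x + t) <> 0) by lra.
        assert (E2 : (x + t) ^ n <> 0) by (apply pow_nonzero; lra).
        assert (I2 := I (n + 2)%nat ltac:(lia)); assert (I3 := I (n + 3)%nat ltac:(lia)).
        assert (I4 := I (n + 4)%nat ltac:(lia)).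
        replace (S (n + 1)) with (n + 2)%nat by lia.
        replace (S (n + 2)) with (n + 3)%nat by lia.
        replace (S (n + 3)) with (n + 4)%nat by lia.
        replace (n + 2 + 2)%nat with (n + 4)%nat by lia.
        replace (n + 2 + 3)%nat with (n + 5)%nat by lia.
        replace (S (n + 4)) with (n + 5)%nat by lia.
        change ((-1) ^ S m) with (-1 * s); change ((-1) ^ S (S m)) with (-1 * (-1 * s)).
        set (b2 := bern (n + 2) t); set (b20 := bern (n + 2) 0).
        set (b3 := bern (n + 3) t); set (b4 := bern (n + 4) t); set (b40 := bern (n + 4) 0).
        clearbody b2 b20 b3 b4 b40 s.
        assert (Pw : forall k, (x + t) ^ (n + k) = (x + t) ^ n * (x + t) ^ k)
          by (intros; apply pow_add).
        rewrite !Pw.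
        set (i2 := INR (n + 2)) in *; set (i3 := INR (n + 3)) in *; set (i4 := INR (n + 4)) in *.
        clearbody i2 i3 i4; unfold zero, minus, plus, opp; simpl.
        field; auto.
    + rewrite Rplus_0_r.
      (* At the endpoints the summand of order [n + 4] is 0 because both values of the polynomial
         agree, and that of order [n + 3] because the index is odd. Only the last summand adds to
         [- F]. *)
      replace (n + 4)%nat with (S (S (n + 2))) by lia; rewrite bern_at_1.
      replace (n + 3)%nat with (S (S (n + 1))) by lia; rewrite bern_at_1.
      replace (S (S (n + 1))) with (n + 3)%nat by lia.
      assert (O3 := bern_odd_0 m); rewrite <- En in O3; rewrite O3.
      simpl em_step; rewrite <- EF; fold s.
      replace (m + (m + 0) + 2)%nat with (n + 2)%nat by lia.
      assert (I2 := I (n + 2)%nat ltac:(lia)); assert (I3 := I (n + 3)%nat ltac:(lia)).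
      assert (I4 := I (S (S (n + 2))) ltac:(lia)).
      unfold Rdiv; ring.
Qed.

(** The mean value theorem turns the increment of the antiderivative into a value of the integrand
    inside (0, 1), where [bern_even_sign] gives its sign. *)
Lemma em_step_pos m x : 0 < x -> 0 < em_step m x.
Proof.
  intros Hx; destruct (em_step_antiderivative m x Hx) as (F & DF & <-).
  destruct (mean_value F _ 0 1 Rlt_0_1 DF) as (c & Hc & ->).
  assert (P := bern_even_sign m c Hc).
  assert (0 < (x + c) ^ (2 * m + 3)) by (apply pow_lt; lra).
  rewrite Rminus_0_r, Rmult_1_r; apply Rdiv_lt_0_compat; assumption.
Qed.

(** * Harmonic numbers and the remainders at integers *)

Definition harmonic (n : nat) : R := sum_n_m (fun k => / INR k) 1 n.

Lemma harmonic_S n : harmonic (S n) = harmonic n + / INR (S n).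
Proof. unfold harmonic; rewrite sum_n_Sm by lia; reflexivity. Qed.

Lemma ln_le_sub_1 x : 0 < x -> ln x <= x - 1.
Proof.
  intros Hx; destruct (Req_dec (ln x) 0) as [E|E].
  - rewrite <- (exp_ln x Hx) at 2; rewrite E, exp_0; lra.
  - assert (H := exp_ineq1 _ E); rewrite exp_ln in H; lra.
Qed.

(** Both bounds are [ln y <= y - 1], at [y = x / (x + 1)] and at [y = (x + 1) / x]. *)
Lemma ln_succ_bounds x : 0 < x -> / (x + 1) <= ln (x + 1) - ln x <= / x.
Proof.
  intros Hx; split.
  - assert (H := ln_le_sub_1 (x / (x + 1)) ltac:(apply Rdiv_lt_0_compat; lra)).
    rewrite ln_div in H by lra.
    replace (x / (x + 1) - 1) with (- / (x + 1)) in H by (field; lra); lra.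
  - rewrite <- ln_div by lra.
    assert (H := ln_le_sub_1 ((x + 1) / x) ltac:(apply Rdiv_lt_0_compat; lra)).
    replace ((x + 1) / x - 1) with (/ x) in H by (field; lra); lra.
Qed.

(** The sequence decreases and is bounded below by 0 from index 1 on. This shows that [euler_gamma]
    is a genuine finite limit and not a default value of [real] or [Lim_seq]. *)
Lemma euler_gamma_lim : is_lim_seq (fun n => harmonic n - ln (INR n)) euler_gamma.
Proof.
  assert (P : forall n, 0 < INR (S n)) by (intros; apply lt_0_INR; lia).
  assert (C : ex_finite_lim_seq (fun n => harmonic (S n) - ln (INR (S n)))).
  2: { destruct C as (l & Hl).
       apply (is_lim_seq_incr_1 (fun n => harmonic n - ln (INR n))) in Hl.
       unfold euler_gamma; fold harmonic.
       change (fun n => sum_n_m (fun k => / INR k) 1 n - ln (INR n))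
         with (fun n => harmonic n - ln (INR n)).
       rewrite (is_lim_seq_unique _ _ Hl); exact Hl. }
  apply (ex_finite_lim_seq_decr _ 0).
  - intros n; assert (B := ln_succ_bounds _ (P n)).
    rewrite (harmonic_S (S n)), (S_INR (S n)); lra.
  - intros n.
    assert (ln (INR (S n) + 1) <= harmonic (S n)).
    { induction n as [|n IH].
      - assert (B := ln_succ_bounds 1 Rlt_0_1); rewrite ln_1 in B.
        unfold harmonic; rewrite sum_n_n; simpl; lra.
      - assert (B := ln_succ_bounds _ (P (S n))).
        rewrite harmonic_S; rewrite (S_INR (S n)) in B |- * ; lra. }
    assert (B := ln_succ_bounds _ (P n)); assert (0 < / (INR (S n) + 1))
      by (apply Rinv_0_lt_compat; specialize (P n); lra); lra.
Qed.

(* Index shift: [em_rem m] and [em_step m] are [r_(m+1)] and its increment. *)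
Fixpoint em_rem (m n : nat) : R :=
  match m with
  | O => euler_gamma + ln (INR n) - harmonic n + / (2 * INR n)
  | S k => (-1) ^ k * bern (2 * k + 2) 0 / INR (2 * k + 2) * / INR n ^ (2 * k + 2)
           - em_rem k n
  end.

Lemma em_rem_diff m n : (0 < n)%nat ->
  em_rem m n - em_rem m (S n) = em_step m (INR n).
Proof.
  intros Hn; assert (P : 0 < INR n) by (apply lt_0_INR; lia).
  induction m as [|m IH].
  - cbn [em_rem em_step]; rewrite harmonic_S, S_INR; field; lra.
  - cbn [em_rem em_step]; rewrite <- IH, <- (S_INR n); ring.
Qed.

Lemma is_lim_seq_inv_INR : is_lim_seq (fun n => / INR n) 0.
Proof.
  apply (is_lim_seq_inv _ p_infty); [apply is_lim_seq_INR|discriminate].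
Qed.

Lemma is_lim_seq_inv_INR_pow k : is_lim_seq (fun n => / INR n ^ S k) 0.
Proof.
  apply (is_lim_seq_ext (fun n => (/ INR n) ^ S k)); [intros; apply pow_inv|].
  induction k as [|k IH].
  - apply (is_lim_seq_ext (fun n => / INR n)); [intros; simpl; ring|].
    apply is_lim_seq_inv_INR.
  - apply (is_lim_seq_ext (fun n => / INR n * (/ INR n) ^ S k)); [reflexivity|].
    replace 0 with (0 * 0) by ring.
    apply is_lim_seq_mult'; [apply is_lim_seq_inv_INR|exact IH].
Qed.

(** Level 0 is the definition of Euler's constant; each further level brings in only a negative
    power of [n]. *)
Lemma em_rem_lim m : is_lim_seq (em_rem m) 0.
Proof.
  induction m as [|m IH].
  - apply (is_lim_seq_ext (fun n => euler_gamma - (harmonic n - ln (INR n)) + / 2 * / INR n)).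
    { intros n; simpl; rewrite Rinv_mult; ring. }
    replace 0 with (euler_gamma - euler_gamma + / 2 * 0) by ring.
    apply is_lim_seq_plus'; [apply is_lim_seq_minus'|].
    + apply is_lim_seq_const.
    + apply euler_gamma_lim.
    + apply is_lim_seq_mult'; [apply is_lim_seq_const|apply is_lim_seq_inv_INR].
  - cbn [em_rem]; set (c := _ / _).
    replace 0 with (c * 0 - 0) by ring.
    apply is_lim_seq_minus'; [|exact IH].
    apply is_lim_seq_mult'; [apply is_lim_seq_const|].
    replace (2 * m + 2)%nat with (S (2 * m + 1)) by lia.
    apply is_lim_seq_inv_INR_pow.
Qed.

Lemma em_rem_decr m n k : (0 < n)%nat -> (n < k)%nat -> em_rem m k < em_rem m n.
Proof.
  intros Hn; induction 1 as [|k H IH];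
    [assert (E := em_rem_diff m n Hn)|assert (E := em_rem_diff m k ltac:(lia))];
    [assert (P := em_step_pos m (INR n) ltac:(apply lt_0_INR; lia))
    |assert (P := em_step_pos m (INR k) ltac:(apply lt_0_INR; lia))]; lra.
Qed.

(** Leibniz' criterion. The sum is at least the partial sum [u 0 - u 1], which is positive because
    the decrease is strict. *)
Lemma alternating_series_pos (u : nat -> R) :
  (forall n, u (S n) < u n) -> is_lim_seq u 0 ->
  ex_series (fun n => (-1) ^ n * u n) /\ 0 < Series (fun n => (-1) ^ n * u n).
Proof.
  intros Du Lu.
  assert (Du' : Un_decreasing u) by (intros n; apply Rlt_le, Du).
  apply is_lim_seq_Reals in Lu.
  destruct (alternated_series u Du' Lu) as (l & Hl).
  assert (Sl : is_series (fun n => (-1) ^ n * u n) l).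
  { apply is_series_Reals; exact Hl. }
  split; [exists l; exact Sl|].
  rewrite (is_series_unique _ _ Sl).
  destruct (alternated_series_ineq u l 0 Du' Lu Hl) as [H _].
  unfold tg_alt in H; simpl in H; specialize (Du 0%nat); lra.
Qed.

Lemma eta_alternating s : (1 <= s)%nat ->
  ex_series (fun j => (-1) ^ j / INR (j + 1) ^ s) /\ 0 < eta s.
Proof.
  intros Hs; destruct s as [|s]; [lia|].
  apply (alternating_series_pos (fun j => / INR (j + 1) ^ S s)).
  - intros n; apply Rinv_lt_contravar.
    + apply Rmult_lt_0_compat; apply pow_lt, lt_0_INR; lia.
    + assert (A : 0 < INR (n + 1)) by (apply lt_0_INR; lia).
      assert (A' : INR (n + 1) < INR (S n + 1)) by (apply lt_INR; lia).
      clear Hs; induction s as [|s IH]; [lra|].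
      change (INR (n + 1) * INR (n + 1) ^ S s < INR (S n + 1) * INR (S n + 1) ^ S s).
      apply Rmult_gt_0_lt_compat; auto; [apply pow_lt, A|lra].
  - apply (is_lim_seq_ext (fun j => / INR (S j) ^ S s)).
    { intros n; now rewrite Nat.add_1_r. }
    apply (is_lim_seq_incr_1 (fun j => / INR j ^ S s)), is_lim_seq_inv_INR_pow.
Qed.

(** * Wallis' product *)

Definition sin_pow_int (n : nat) : R := RInt (fun x => sin x ^ n) 0 (PI / 2).

Lemma sin_pow_cont n x : continuous (fun x => sin x ^ n) x.
Proof.
  apply (ex_derive_continuous (V := R_NormedModule)); auto_derive; auto.
Qed.

Lemma sin_pow_ex_RInt n : ex_RInt (fun x => sin x ^ n) 0 (PI / 2).
Proof.
  apply (ex_RInt_continuous (V := R_CompleteNormedModule)); intros; apply sin_pow_cont.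
Qed.

(** Wallis' recurrence: [- cos x * sin x ^ (n + 1)] is an antiderivative of the difference of the
    two integrands and vanishes at 0 and PI/2. *)
Lemma sin_pow_int_rec n :
  INR (n + 2) * sin_pow_int (n + 2) = INR (n + 1) * sin_pow_int n.
Proof.
  set (f x := INR (n + 2) * sin x ^ (n + 2) - INR (n + 1) * sin x ^ n).
  assert (I : is_RInt f 0 (PI / 2) 0).
  { evar_last.
    - apply (is_RInt_derive (V := R_CompleteNormedModule) (fun x => - cos x * sin x ^ (n + 1))).
      + intros x _; unfold f; auto_derive; [auto|].
        replace (Init.Nat.pred (n + 1)) with n by lia.
        rewrite (plus_INR n 2), (plus_INR n 1), !pow_add.
        assert (E := sin2_cos2 x); unfold Rsqr in E; simpl.
        set (s := sin x) in *; set (c := cos x) in *; set (sn := s ^ n).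
        transitivity (s * s * sn - (INR n + 1) * (c * c) * sn); [ring|].
        replace (c * c) with (1 - s * s) by lra; ring.
      + intros x _; apply (ex_derive_continuous (V := R_NormedModule)).
        unfold f; auto_derive; auto.
    - rewrite cos_PI2, sin_0, pow_i by lia.
      unfold minus, plus, opp; simpl; ring. }
  assert (J : is_RInt f 0 (PI / 2)
     (INR (n + 2) * sin_pow_int (n + 2) - INR (n + 1) * sin_pow_int n)).
  { apply (is_RInt_minus (V := R_NormedModule));
      apply (is_RInt_scal (V := R_NormedModule)),
            (RInt_correct (V := R_CompleteNormedModule)), sin_pow_ex_RInt. }
  apply (is_RInt_unique (V := R_CompleteNormedModule)) in I.
  apply (is_RInt_unique (V := R_CompleteNormedModule)) in J.
  rewrite I in J; lra.
Qed.

Lemma sin_PI2_interior x : 0 < x < PI / 2 -> 0 < sin x < 1.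
Proof.
  assert (H := PI_RGT_0); intros Hx; split; [apply sin_gt_0; lra|].
  rewrite <- sin_PI2; apply sin_increasing_1; lra.
Qed.

Lemma sin_pow_int_pos n : 0 < sin_pow_int n.
Proof.
  assert (H := PI_RGT_0); apply RInt_gt_0; [lra| |].
  - intros x Hx; apply pow_lt, sin_PI2_interior, Hx.
  - intros x _; apply sin_pow_cont.
Qed.

Lemma sin_pow_int_decr n : sin_pow_int (S n) <= sin_pow_int n.
Proof.
  assert (H := PI_RGT_0); apply RInt_le; [lra|apply sin_pow_ex_RInt..|].
  intros x Hx; destruct (sin_PI2_interior x Hx) as [H0 H1].
  assert (P := pow_lt _ n H0); simpl; nra.
Qed.

Lemma ln_sin_pow_int_rec n :
  ln (INR (S (S n))) + ln (sin_pow_int (S (S n))) = ln (INR (S n)) + ln (sin_pow_int n).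
Proof.
  assert (E := sin_pow_int_rec n).
  replace (n + 2)%nat with (S (S n)) in E by lia; replace (n + 1)%nat with (S n) in E by lia.
  rewrite <- !ln_mult; try apply sin_pow_int_pos; try (apply lt_0_INR; lia).
  now rewrite E.
Qed.

(** The upper bound is monotonicity. For the lower one, the next integral is smaller still, and its
    ratio to the integral at [n] is exactly (n + 1)/(n + 2) by the recurrence. *)
Lemma ln_sin_pow_int_ratio n :
  - / INR (S n) <= ln (sin_pow_int (S n)) - ln (sin_pow_int n) <= 0.
Proof.
  assert (P := sin_pow_int_pos); assert (D := sin_pow_int_decr).
  assert (Pn : 0 < INR (S n)) by (apply lt_0_INR; lia).
  split.
  - assert (El := ln_sin_pow_int_rec n).
    rewrite (S_INR (S n)) in El; assert (B := ln_succ_bounds _ Pn).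
    assert (L := ln_le _ _ (P _) (D (S n))); lra.
  - assert (L := ln_le _ _ (P _) (D n)); lra.
Qed.

(* The sum on the left plus [(-1) ^ n] times the logarithm of the ratio of two
   consecutive Wallis integrals does not depend on [n]. *)
Lemma wallis_log : is_lim_seq
  (fun n => 2 * sum_n (fun j => (-1) ^ j * ln (INR (S j))) n - (-1) ^ n * ln (INR (S n)))
  (- ln (PI / 2)).
Proof.
  set (v n := (-1) ^ n * (ln (sin_pow_int (S n)) - ln (sin_pow_int n))).
  apply (is_lim_seq_ext (fun n => - ln (PI / 2) - v n)).
  (* The integrals at 0 and 1 fix the invariant: at [n = 0] the left side is 0 and
     [v 0 = - ln (PI / 2)]. *)
  - assert (W0 : sin_pow_int 0 = PI / 2).
    { unfold sin_pow_int; simpl; rewrite RInt_const; unfold scal; simpl; unfold mult; simpl; ring. }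
    assert (W1 : sin_pow_int 1 = 1).
    { apply is_RInt_unique; evar_last.
      - apply (is_RInt_derive (V := R_CompleteNormedModule) (fun x => - cos x)).
        + intros x _; auto_derive; [auto|]; simpl; ring.
        + intros x _; apply sin_pow_cont.
      - rewrite cos_PI2, cos_0; unfold minus, plus, opp; simpl; ring. }
    induction n as [|n IH].
    + rewrite sum_O; unfold v; rewrite W0, W1, ln_1; simpl; rewrite ln_1; ring.
    + rewrite sum_Sn.
      assert (El := ln_sin_pow_int_rec n).
      unfold v in *.
      change ((-1) ^ S n) with (-1 * (-1) ^ n).
      set (s := (-1) ^ n) in *; set (T := sum_n _ n) in *.
      set (L2 := ln (INR (S (S n)))) in *; set (L1 := ln (INR (S n))) in *.
      change (- ln (PI / 2) - -1 * s * (ln (sin_pow_int (S (S n))) - ln (sin_pow_int (S n)))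
        = 2 * (T + -1 * s * L2) - -1 * s * L2).
      replace (ln (sin_pow_int (S (S n)))) with (L1 + ln (sin_pow_int n) - L2) by lra.
      lra.
  - replace (- ln (PI / 2)) with (- ln (PI / 2) - 0) at 1 by ring.
    apply is_lim_seq_minus'; [apply is_lim_seq_const|].
    apply is_lim_seq_abs_0, (is_lim_seq_le_le (fun _ => 0) _ (fun n => / INR (S n))).
    + intros n; split; [apply Rabs_pos|]; unfold v.
      rewrite Rabs_mult, pow_1_abs, Rmult_1_l.
      assert (B := ln_sin_pow_int_ratio n); apply Rabs_le; lra.
    + apply is_lim_seq_const.
    + apply (is_lim_seq_incr_1 (fun n => / INR n)), is_lim_seq_inv_INR.
Qed.

(** * Partial fractions of the cosecant *)

(** A kernel in the style of Dirichlet's, whose integral over [0, PI] is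
    [sin (x * PI) * csc_partial x N]. *)
Definition dirichlet_pair (x : R) (N : nat) (t : R) : R :=
  sum_n (fun j => cos ((INR j + x) * t) + cos ((INR j + 1 - x) * t)) N.

(** Each pair equals 2 cos((x - 1/2) t) cos((j + 1/2) t). The first cosine does not depend on j; the
    second, times sin(t/2), telescopes. *)
Lemma dirichlet_pair_closed x N t :
  sin (t / 2) * dirichlet_pair x N t = cos ((x - 1 / 2) * t) * sin (INR (S N) * t).
Proof.
  unfold dirichlet_pair; induction N as [|N IH].
  - rewrite sum_O, form1; simpl INR.
    replace (((0 + x) * t - (0 + 1 - x) * t) / 2) with ((x - 1 / 2) * t) by field.
    replace (((0 + x) * t + (0 + 1 - x) * t) / 2) with (t / 2) by field.
    replace (1 * t) with (2 * (t / 2)) by field; rewrite sin_2a; ring.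
  - rewrite sum_Sn, form1.
    replace (((INR (S N) + x) * t - (INR (S N) + 1 - x) * t) / 2) with ((x - 1 / 2) * t) by field.
    assert (F := form4 (INR (S (S N)) * t) (INR (S N) * t)).
    replace ((INR (S (S N)) * t - INR (S N) * t) / 2) with (t / 2) in F
      by (rewrite (S_INR (S N)); field).
    replace ((INR (S (S N)) * t + INR (S N) * t) / 2)
      with (((INR (S N) + x) * t + (INR (S N) + 1 - x) * t) / 2) in F
      by (rewrite (S_INR (S N)); field).
    set (c := cos ((x - 1 / 2) * t)) in *.
    set (d := cos (((INR (S N) + x) * t + (INR (S N) + 1 - x) * t) / 2)) in *.
    set (T := sum_n _ N) in *.
    change (sin (t / 2) * (T + 2 * c * d) = c * sin (INR (S (S N)) * t)).
    replace (sin (INR (S (S N)) * t)) with (sin (INR (S N) * t) + 2 * d * sin (t / 2)) by lra.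
    rewrite Rmult_plus_distr_l, IH; ring.
Qed.

(** Partial sums of PI / sin(PI x) as the two-sided series of (-1)^n / (x + n), with the terms n = j
    and n = - j - 1 paired. *)
Definition csc_partial (x : R) (N : nat) : R :=
  sum_n (fun j => (-1) ^ j * (/ (INR j + x) + / (INR j + 1 - x))) N.

Lemma sin_nat_PI_shift j y : sin (INR j * PI + y) = (-1) ^ j * sin y.
Proof.
  induction j as [|j IH]; [simpl; rewrite Rmult_0_l, Rplus_0_l; ring|].
  rewrite S_INR; replace ((INR j + 1) * PI + y) with (INR j * PI + y + PI) by ring.
  rewrite neg_sin, IH; simpl; ring.
Qed.

Lemma dirichlet_pair_antiderivative x N : 0 < x < 1 -> exists F,
  (forall t, is_derive F t (dirichlet_pair x N t)) /\ F 0 = 0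
  /\ F PI = sin (x * PI) * csc_partial x N.
Proof.
  intros Hx; assert (P : forall j, 0 <= INR j) by (intros; apply pos_INR).
  unfold dirichlet_pair, csc_partial.
  set (G j t := sin ((INR j + x) * t) / (INR j + x)
                  + sin ((INR j + 1 - x) * t) / (INR j + 1 - x)).
  assert (DG : forall j t, is_derive (G j) t
             (cos ((INR j + x) * t) + cos ((INR j + 1 - x) * t))).
  { intros j t; specialize (P j); unfold G; auto_derive; [lra|field; lra]. }
  exists (fun t => sum_n (fun j => G j t) N); split; [|split].
  - intros t; apply (is_derive_sum_n (V := R_NormedModule)); intros; apply DG.
  - transitivity (sum_n (fun _ : nat => 0) N).
    + apply sum_n_ext; intros j.
      assert (E : G j 0 = 0); [|exact E].
      specialize (P j); unfold G; rewrite !Rmult_0_r, sin_0; field; lra.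
    + rewrite sum_n_const; apply Rmult_0_r.
  - rewrite <- (sum_n_mult_l (K := R_Ring)); apply sum_n_ext; intros j; unfold G.
    specialize (P j).
    replace ((INR j + x) * PI) with (INR j * PI + x * PI) by ring.
    replace ((INR j + 1 - x) * PI) with (INR j * PI + (PI - x * PI)) by ring.
    rewrite !sin_nat_PI_shift, sin_PI_x; unfold mult; simpl; field; lra.
Qed.

(** With [c = x - 1 / 2], this is the amplitude of sin((N + 1) t) in the difference of the kernels
    at x and at 1/2. *)
Definition csc_defect (c t : R) : R := (cos (c * t) - 1) / sin (t / 2).

(** Write sin(t/2) = 2 sin(t/4) cos(t/4). Since t/4 <= PI/4 < PI/3, cosines up to t/4 are at least
    1/2, so sin(t/4) >= t/8. *)
Lemma sin_half_ge t : 0 < t <= PI -> t / 8 <= sin (t / 2).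
Proof.
  intros Ht; assert (H := PI_RGT_0).
  replace (t / 2) with (2 * (t / 4)) by field; rewrite sin_2a.
  assert (C : forall z, 0 <= z <= t / 4 -> 1 / 2 <= cos z).
  { intros z Hz; rewrite <- cos_PI3; apply cos_decr_1; lra. }
  destruct (mean_value sin cos 0 (t / 4)) as (z & Hz & E); [lra| |].
  { intros; auto_derive; [auto|ring]. }
  rewrite sin_0 in E; assert (C1 := C z ltac:(lra)); assert (C2 := C (t / 4) ltac:(lra)).
  assert (t / 8 <= sin (t / 4)) by nra.
  nra.
Qed.

Lemma sin_lipschitz_0 y : sin y * sin y <= y * y.
Proof.
  destruct (MVT_gen sin 0 y cos) as (c & _ & E).
  - intros; auto_derive; [auto|ring].
  - intros; apply continuity_sin.
  - rewrite sin_0, !Rminus_0_r in E; rewrite E.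
    assert (S := sin2_cos2 c); unfold Rsqr in S; nra.
Qed.

Lemma one_minus_cos_bound u : 0 <= 1 - cos u <= u * u / 2.
Proof.
  replace (cos u) with (cos (2 * (u / 2))) by (f_equal; field); rewrite cos_2a_sin.
  assert (B := sin_lipschitz_0 (u / 2)); nra.
Qed.

(** The numerator is at most t^2/2 and the denominator at least t/8, so the quotient is at most 4 t,
    and PI <= 4. *)
Lemma csc_defect_bound c t : Rabs c <= 1 -> 0 < t <= PI -> Rabs (csc_defect c t) <= 16.
Proof.
  intros Hc Ht; assert (S := sin_half_ge t Ht); assert (P4 := PI_4).
  assert (C := one_minus_cos_bound (c * t)).
  unfold csc_defect.
  rewrite Rabs_div, (Rabs_pos_eq (sin (t / 2))) by lra.
  apply Rle_div_l; [lra|].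
  rewrite Rabs_minus_sym, Rabs_pos_eq by lra.
  apply Rabs_le_between in Hc.
  assert (c * c <= 1) by nra.
  assert (c * t * (c * t) <= 1 * (t * t)) by nra.
  nra.
Qed.

Definition csc_defect_derivative (c t : R) : R :=
  (- c * sin (c * t) * sin (t / 2) - (cos (c * t) - 1) * cos (t / 2) / 2)
  / (sin (t / 2) * sin (t / 2)).

Lemma csc_defect_is_derive c t : 0 < t <= PI ->
  is_derive (csc_defect c) t (csc_defect_derivative c t).
Proof.
  intros Ht; assert (S := sin_half_ge t Ht).
  unfold csc_defect, csc_defect_derivative; auto_derive; [lra|].
  change (t * / 2) with (t / 2); field; lra.
Qed.

(** The numerator is at most t^2/2 + t^2/4 and the denominator at least t^2/64, so the bound is
    uniform down to 0. *)
Lemma csc_defect_derivative_bound c t : Rabs c <= 1 -> 0 < t <= PI ->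
  Rabs (csc_defect_derivative c t) <= 64.
Proof.
  intros Hc Ht; assert (S := sin_half_ge t Ht).
  assert (C := one_minus_cos_bound (c * t)).
  apply Rabs_le_between in Hc.
  assert (c * c <= 1) by nra.
  assert (Ct : c * t * (c * t) <= t * t) by nra.
  assert (S1 := sin_lipschitz_0 (c * t)); assert (S2 := sin_lipschitz_0 (t / 2)).
  assert (B1 : Rabs (sin (c * t)) <= t) by (apply Rabs_le; split; nra).
  assert (B2 : Rabs (sin (t / 2)) <= t / 2) by (apply Rabs_le; split; nra).
  assert (B3 : Rabs (cos (t / 2)) <= 1) by (apply Rabs_le, COS_bound).
  assert (B4 : Rabs (- c) <= 1) by (rewrite Rabs_Ropp; apply Rabs_le; lra).
  assert (B5 : Rabs (cos (c * t) - 1) <= t * t / 2) by (rewrite Rabs_minus_sym, Rabs_pos_eq; lra).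
  unfold csc_defect_derivative.
  rewrite Rabs_div, (Rabs_pos_eq (sin (t / 2) * sin (t / 2))) by nra.
  assert (Q : t * t / 64 <= sin (t / 2) * sin (t / 2)) by nra.
  apply Rle_div_l; [nra|].
  apply Rle_trans with (t * t); [|nra].
  eapply Rle_trans; [apply Rabs_triang|].
  rewrite Rabs_Ropp, Rabs_div, !Rabs_mult, (Rabs_pos_eq 2) by lra.
  assert (T1 : Rabs (- c) * Rabs (sin (c * t)) * Rabs (sin (t / 2)) <= 1 * t * (t / 2)).
  { apply Rmult_le_compat; try apply Rabs_pos; auto.
    - apply Rmult_le_pos; apply Rabs_pos.
    - apply Rmult_le_compat; auto; apply Rabs_pos. }
  assert (T2 : Rabs (cos (c * t) - 1) * Rabs (cos (t / 2)) <= t * t / 2 * 1).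
  { apply Rmult_le_compat; try apply Rabs_pos; auto. }
  lra.
Qed.

(* Integration by parts against [sin (M t)], away from the removable
   singularity at 0. *)
Lemma riemann_lebesgue_defect c (F : R -> R) M d : Rabs c <= 1 -> 0 < M -> 0 < d < PI ->
  (forall t, d <= t <= PI -> is_derive F t (csc_defect c t * sin (M * t))) ->
  Rabs (F PI - F d) <= 300 / M.
Proof.
  intros Hc HM Hd DF.
  set (G t := F t + csc_defect c t * cos (M * t) / M).
  destruct (mean_value G (fun t => csc_defect_derivative c t * cos (M * t) / M) d PI)
    as (z & Hz & E); [lra| |].
  { intros t Ht; unfold G; evar_last.
    - apply (is_derive_plus (V := R_NormedModule)); [apply DF, Ht|].
      apply (is_derive_ext (fun t => csc_defect c t * (cos (M * t) / M))).
      { intros; unfold Rdiv; symmetry; apply Rmult_assoc. }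
      apply (is_derive_mult (csc_defect c) (fun t => cos (M * t) / M)).
      + apply csc_defect_is_derive; lra.
      + auto_derive; [auto|reflexivity].
      + apply Rmult_comm.
    - unfold plus, mult; simpl; field; lra. }
  unfold G in E.
  assert (K1 := csc_defect_bound c PI Hc ltac:(lra)).
  assert (K2 := csc_defect_bound c d Hc ltac:(lra)).
  assert (K3 := csc_defect_derivative_bound c z Hc ltac:(lra)).
  assert (Cb : forall y, Rabs (cos y) <= 1) by (intros; apply Rabs_le, COS_bound).
  assert (P4 := PI_4).
  set (u1 := csc_defect c PI) in *; set (u2 := csc_defect c d) in *.
  set (u3 := csc_defect_derivative c z) in *.
  replace (F PI - F d)
    with ((u3 * cos (M * z) * (PI - d) - u1 * cos (M * PI) + u2 * cos (M * d)) / M).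
  2: { replace (F PI) with (F PI + u1 * cos (M * PI) / M - (u1 * cos (M * PI) / M)) by ring.
       replace (F PI + u1 * cos (M * PI) / M)
         with (F d + u2 * cos (M * d) / M + u3 * cos (M * z) / M * (PI - d)) by lra.
       field; lra. }
  assert (A : forall u v k, Rabs u <= k -> Rabs v <= 1 -> Rabs (u * v) <= k).
  { intros u v k Hu Hv; rewrite Rabs_mult; assert (0 <= Rabs u) by apply Rabs_pos; nra. }
  assert (A1 := A u1 _ _ K1 (Cb (M * PI))); assert (A2 := A u2 _ _ K2 (Cb (M * d))).
  assert (A3 := A u3 _ _ K3 (Cb (M * z))).
  apply Rabs_le_between in A1; apply Rabs_le_between in A2; apply Rabs_le_between in A3.
  unfold Rdiv; rewrite Rabs_mult, Rabs_inv, (Rabs_pos_eq M) by lra.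
  apply Rmult_le_compat_r; [apply Rlt_le, Rinv_0_lt_compat, HM|].
  (* The two boundary values and the derivative over a length below 4 give 16 + 16 + 64 * 4 =
     288. *)
  apply Rabs_le; nra.
Qed.

(** Both terms are integrals of kernels over [0, PI], and the kernels differ by a bounded smooth
    amplitude times sin((N + 1) t), so oscillation makes the difference O(1/N). *)
Lemma csc_partial_diff x N : 0 < x < 1 ->
  Rabs (sin (x * PI) * csc_partial x N - csc_partial (1 / 2) N) <= 301 / INR (S N).
Proof.
  intros Hx; assert (H := PI_RGT_0).
  assert (HN : 0 < INR (S N)) by (apply lt_0_INR; lia).
  destruct (dirichlet_pair_antiderivative x N Hx) as (F1 & D1 & Z1 & E1).
  destruct (dirichlet_pair_antiderivative (1 / 2) N ltac:(lra)) as (F2 & D2 & Z2 & E2).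
  replace (1 / 2 * PI) with (PI / 2) in E2 by field.
  rewrite sin_PI2, Rmult_1_l in E2; rewrite <- E1, <- E2.
  set (F t := F1 t - F2 t).
  assert (D : forall t, is_derive F t (dirichlet_pair x N t - dirichlet_pair (1 / 2) N t))
    by (intros; apply (is_derive_minus (V := R_NormedModule)); [apply D1|apply D2]).
  assert (Cont : continuous F 0) by
    (apply (ex_derive_continuous (V := R_NormedModule)); eexists; apply D).
  assert (Hl : 0 < / INR (S N)) by (apply Rinv_0_lt_compat, HN).
  apply (filterlim_locally F (F 0)) with (eps := mkposreal _ Hl) in Cont.
  destruct Cont as (r & Hr); assert (Rp := cond_pos r).
  (* The cutoff [d] is so close to 0 that [0, d] contributes less than 1/(N + 1), which is the step
     from 300 to 301. *)
  set (d := Rmin (r / 2) (PI / 2)).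
  assert (Hd : 0 < d < PI).
  { unfold d; split; [apply Rmin_pos; lra|].
    apply Rle_lt_trans with (PI / 2); [apply Rmin_r|lra]. }
  assert (Hdr : d < r) by (apply Rle_lt_trans with (r / 2); [apply Rmin_l|lra]).
  assert (Near : Rabs (F d - F 0) < / INR (S N)).
  { apply (Hr d). change (Rabs (d - 0) < r); rewrite Rminus_0_r, Rabs_pos_eq; lra. }
  assert (Far : Rabs (F PI - F d) <= 300 / INR (S N)).
  { apply (riemann_lebesgue_defect (x - 1 / 2)); auto; [apply Rabs_le; lra|].
    intros t Ht; evar_last; [apply D|].
    assert (S := sin_half_ge t ltac:(lra)).
    apply (Rmult_eq_reg_l (sin (t / 2))); [|lra].
    rewrite Rmult_minus_distr_l, !dirichlet_pair_closed.
    replace ((1 / 2 - 1 / 2) * t) with 0 by field; rewrite cos_0.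
    unfold csc_defect; field; lra. }
  replace (F1 PI - F2 PI) with ((F PI - F d) + (F d - F 0))
    by (unfold F; rewrite Z1, Z2; ring).
  eapply Rle_trans; [apply Rabs_triang|].
  unfold Rdiv in *; lra.
Qed.

(** At x = 1/2 the terms are 4 (-1)^j / (2 j + 1), Leibniz' series for PI. *)
Lemma csc_partial_half : is_lim_seq (csc_partial (1 / 2)) PI.
Proof.
  rewrite <- Alt_PI_eq; unfold Alt_PI; destruct exist_PI as (l & Hl).
  apply is_lim_seq_Reals in Hl.
  apply (is_lim_seq_ext (fun N => 4 * sum_f_R0 (tg_alt PI_tg) N)).
  - intros N; unfold csc_partial; rewrite <- sum_n_Reals.
    rewrite <- (sum_n_mult_l (K := R_Ring)); apply sum_n_ext; intros j.
    unfold tg_alt, PI_tg, mult; simpl mult.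
    assert (P := pos_INR j); rewrite plus_INR, mult_INR; simpl; field; lra.
  - apply (is_lim_seq_scal_l _ 4 l), Hl.
Qed.

Lemma csc_partial_lim x : 0 < x < 1 ->
  is_lim_seq (csc_partial x) (PI / sin (x * PI)).
Proof.
  intros Hx; assert (H := PI_RGT_0).
  assert (S : 0 < sin (x * PI)) by (apply sin_gt_0; nra).
  apply (is_lim_seq_ext (fun N => / sin (x * PI)
     * ((sin (x * PI) * csc_partial x N - csc_partial (1 / 2) N) + csc_partial (1 / 2) N))).
  { intros N; field; lra. }
  replace (PI / sin (x * PI)) with (/ sin (x * PI) * (0 + PI)) by (field; lra).
  apply is_lim_seq_mult'; [apply is_lim_seq_const|].
  apply is_lim_seq_plus'; [|apply csc_partial_half].
  apply is_lim_seq_abs_0, (is_lim_seq_le_le (fun _ => 0) _ (fun N => 301 * / INR (N + 1))).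
  - intros N; split; [apply Rabs_pos|].
    rewrite Nat.add_1_r; apply csc_partial_diff, Hx.
  - apply is_lim_seq_const.
  - replace 0 with (301 * 0) by ring.
    apply is_lim_seq_mult'; [apply is_lim_seq_const|].
    apply (is_lim_seq_incr_n (fun n => / INR n) 1), is_lim_seq_inv_INR.
Qed.

(** * The cosecant sum *)

Ltac as_real_eq :=
  repeat match goal with
    | |- context [@plus ?G] => change (@plus G) with Rplus
    | |- context [@mult ?G] => change (@mult G) with Rmult
    end;
  match goal with |- ?a = ?b => change (@eq R a b) end.

Lemma is_lim_seq_sum_n (u : nat -> nat -> R) (l : nat -> R) n :
  (forall i, (i <= n)%nat -> is_lim_seq (u i) (l i)) ->
  is_lim_seq (fun N => sum_n (fun i => u i N) n) (sum_n l n).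
Proof.
  induction n as [|n IH]; intros H.
  - apply (is_lim_seq_ext (u 0%nat)); [intros; now rewrite sum_O|].
    rewrite sum_O; apply H; lia.
  - apply (is_lim_seq_ext (fun N => sum_n (fun i => u i N) n + u (S n) N)).
    { intros; now rewrite sum_Sn. }
    rewrite sum_Sn; apply is_lim_seq_plus'; [apply IH; intros|]; apply H; lia.
Qed.

Lemma harmonic_block_up a n :
  sum_n (fun i => / INR (a + S i)) n = harmonic (a + S n) - harmonic a.
Proof.
  induction n as [|n IH].
  - rewrite sum_O, Nat.add_1_r, harmonic_S; as_real_eq; ring.
  - rewrite sum_Sn, IH, (Nat.add_succ_r a (S n)), harmonic_S; as_real_eq; ring.
Qed.

Lemma harmonic_block_down b n : (n < b)%nat ->
  sum_n (fun i => / INR (b - i)) n = harmonic b - harmonic (b - S n).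
Proof.
  intros Hn; induction n as [|n IH].
  - rewrite sum_O, Nat.sub_0_r; destruct b as [|b]; [lia|].
    rewrite harmonic_S; replace (S b - 1)%nat with b by lia; as_real_eq; ring.
  - rewrite sum_Sn, IH by lia.
    replace (b - S n)%nat with (S (b - S (S n))) by lia; rewrite harmonic_S.
    as_real_eq; ring.
Qed.

(** At x = k/p the j-th term is p (1/(jp + k) + 1/((j + 1)p - k)) up to sign. As k runs over 1, ...,
    p - 1, both fractions run through the same harmonic block, once upwards and once downwards,
    hence the factor 2 p. *)
Lemma csc_partial_sum q N :
  let p := S (S q) in
  sum_n (fun i => csc_partial (INR (S i) / INR p) N) q
  = 2 * INR p * sum_n (fun j => (-1) ^ j * (harmonic (j * p + S q) - harmonic (j * p))) N.
Proof.
  intros p; unfold csc_partial; rewrite sum_n_switch.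
  rewrite <- (sum_n_mult_l (K := R_Ring)); apply sum_n_ext; intros j.
  assert (Pp : 0 < INR p) by (apply lt_0_INR; unfold p; lia).
  transitivity (sum_n (fun i => (-1) ^ j * INR p *
     (/ INR (j * p + S i) + / INR (j * p + S q - i))) q).
  - apply sum_n_ext_loc; intros i Hi.
    assert (P1 : 0 < INR (j * p + S i)) by (apply lt_0_INR; lia).
    assert (P2 : 0 < INR (j * p + S q - i)) by (apply lt_0_INR; lia).
    assert (E2 : INR (j * p + S q - i) = (INR j + 1) * INR p - INR (S i)).
    { rewrite minus_INR by lia; unfold p; rewrite plus_INR, mult_INR, !S_INR; ring. }
    assert (E1 : INR (j * p + S i) = INR j * INR p + INR (S i))
      by (rewrite plus_INR, mult_INR; ring).
    rewrite E1 in P1 |- *; rewrite E2 in P2 |- *.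
    assert (X : (-1) ^ j * (/ (INR j + INR (S i) / INR p) + / (INR j + 1 - INR (S i) / INR p))
      = (-1) ^ j * INR p * (/ (INR j * INR p + INR (S i)) + / ((INR j + 1) * INR p - INR (S i))));
      [|exact X].
    set (y := INR (S i)) in *; clearbody y; field; repeat split; lra.
  - rewrite (sum_n_mult_l (K := R_Ring)), (sum_n_plus (G := R_AbelianMonoid)).
    rewrite harmonic_block_up, harmonic_block_down by lia.
    replace (j * p + S q - S q)%nat with (j * p)%nat by lia.
    as_real_eq.
    set (h1 := harmonic (j * p + S q)); set (h2 := harmonic (j * p)); clearbody h1 h2.
    assert (X : (-1) ^ j * INR p * (h1 - h2 + (h1 - h2))
      = 2 * INR p * ((-1) ^ j * (h1 - h2))) by ring.
    exact X.
Qed.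

(** In the alternating sum each interior [harmonic (S j * p)] occurs twice, so its expansion term
    1/(2n), doubled, cancels the 1/n missing from the block. Constants collapse to a single copy,
    and the last index, which occurs once, leaves the boundary terms. *)
Lemma alternating_harmonic_blocks q N :
  let p := S (S q) in
  sum_n (fun j => (-1) ^ j * (harmonic (j * p + S q) - harmonic (j * p))) N
  = euler_gamma + ln (INR p)
    + (2 * sum_n (fun j => (-1) ^ j * ln (INR (S j))) N - (-1) ^ N * ln (INR (S N)))
    - 2 * sum_n (fun j => (-1) ^ j * em_rem 0 (S j * p)) N
    + (-1) ^ N * (em_rem 0 (S N * p) - / (2 * INR (S N * p))).
Proof.
  intros p; assert (Pp : 0 < INR p) by (apply lt_0_INR; unfold p; lia).
  assert (E : forall j, harmonic (j * p + S q) = harmonic (S j * p) - / INR (S j * p)).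
  { intros j; replace (S j * p)%nat with (S (j * p + S q)) by (unfold p; lia).
    rewrite (harmonic_S (j * p + S q)); ring. }
  assert (R0 : forall j, em_rem 0 (S j * p) = euler_gamma + (ln (INR (S j)) + ln (INR p))
     - harmonic (S j * p) + / 2 * / INR (S j * p)).
  { intros j; cbn [em_rem]; rewrite <- ln_mult, <- mult_INR, Rinv_mult; auto.
    apply lt_0_INR; lia. }
  induction N as [|N IH].
  - rewrite !sum_O, E, !R0.
    (* The first block starts at an empty harmonic sum, so the expansion is never applied at 0. *)
    change (harmonic (0 * p)) with (harmonic 0).
    replace (harmonic 0) with 0 by (unfold harmonic; now rewrite sum_n_m_zero by lia).
    rewrite Rinv_mult; simpl pow; as_real_eq; field.
    apply not_0_INR; unfold p; lia.
  - rewrite !sum_Sn, IH, E, !R0.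
    assert (Q1 : INR (S N * p) <> 0) by (apply not_0_INR; unfold p; lia).
    assert (Q2 : INR (S (S N) * p) <> 0) by (apply not_0_INR; unfold p; lia).
    rewrite !Rinv_mult.
    change ((-1) ^ S N) with (-1 * (-1) ^ N).
    set (s := (-1) ^ N); set (A := sum_n _ N); set (C := sum_n _ N).
    set (h1 := harmonic (S N * p)); set (h2 := harmonic (S (S N) * p)).
    set (i1 := INR (S N * p)) in *; set (i2 := INR (S (S N) * p)) in *.
    set (L1 := ln (INR (S N))); set (L2 := ln (INR (S (S N)))).
    clearbody s A C h1 h2 i1 i2 L1 L2.
    as_real_eq; field; auto.
Qed.

(** The sum over j >= 1 of (-1)^(j - 1) r_(m+1)(j p), with j shifted to start at 0. *)
Definition alt_rem (m p : nat) : R := Series (fun j => (-1) ^ j * em_rem m (S j * p)).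

Lemma filterlim_S_mul p : (0 < p)%nat ->
  filterlim (fun j => (S j * p)%nat) eventually eventually.
Proof.
  intros Hp; apply eventually_subseq; intros n; lia.
Qed.

Lemma alt_rem_pos m p : (0 < p)%nat ->
  ex_series (fun j => (-1) ^ j * em_rem m (S j * p)) /\ 0 < alt_rem m p.
Proof.
  intros Hp; apply (alternating_series_pos (fun j => em_rem m (S j * p))).
  - intros n; apply em_rem_decr; lia.
  - apply (is_lim_seq_subseq (em_rem m)); [apply filterlim_S_mul, Hp|apply em_rem_lim].
Qed.

(** The same sequence of partial sums has two limits: one by the partial fractions of the cosecant,
    the other by the expansion of the harmonic blocks. *)
Lemma cosecant_sum_alt_rem p : (2 <= p)%nat ->
  PI * cosecant_sum p
  = 2 * INR p * (euler_gamma + ln (INR p) - ln (PI / 2) - 2 * alt_rem 0 p).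
Proof.
  intros Hp; destruct p as [|[|q]]; try lia; set (p := S (S q)).
  assert (Pp : 0 < INR p) by (apply lt_0_INR; lia).
  set (T := fun N => sum_n (fun j => (-1) ^ j * (harmonic (j * p + S q) - harmonic (j * p))) N).
  assert (L1 : is_lim_seq (fun N => 2 * INR p * T N) (PI * cosecant_sum p)).
  { replace (PI * cosecant_sum p) with (sum_n (fun i => PI / sin (INR (S i) / INR p * PI)) q).
    - apply (is_lim_seq_ext (fun N => sum_n (fun i => csc_partial (INR (S i) / INR p) N) q)).
      { intros N; apply csc_partial_sum. }
      apply is_lim_seq_sum_n; intros i Hi; apply csc_partial_lim.
      split; [apply Rdiv_lt_0_compat; [apply lt_0_INR; lia|exact Pp]|].
      apply Rlt_div_l; [exact Pp|rewrite Rmult_1_l; apply lt_INR; unfold p; lia].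
    - unfold cosecant_sum; replace (p - 1)%nat with (S q) by (unfold p; lia).
      rewrite <- (sum_n_m_mult_l (K := R_Ring)), <- sum_n_m_S.
      apply sum_n_m_ext; intros i.
      assert (X : PI / sin (INR (S i) / INR p * PI) = PI * (1 / sin (INR (S i) * PI / INR p)));
        [|exact X].
      replace (INR (S i) * PI / INR p) with (INR (S i) / INR p * PI) by (field; lra).
      unfold Rdiv; ring. }
  set (l := euler_gamma + ln (INR p) - ln (PI / 2) - 2 * alt_rem 0 p).
  assert (L2 : is_lim_seq T l).
  { apply (is_lim_seq_ext (fun N => euler_gamma + ln (INR p)
      + (2 * sum_n (fun j => (-1) ^ j * ln (INR (S j))) N - (-1) ^ N * ln (INR (S N)))
      - 2 * sum_n (fun j => (-1) ^ j * em_rem 0 (S j * p)) N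
      + (-1) ^ N * (em_rem 0 (S N * p) - / (2 * INR (S N * p))))).
    { intros N; symmetry; apply alternating_harmonic_blocks. }
    replace l with (euler_gamma + ln (INR p) + - ln (PI / 2) - 2 * alt_rem 0 p + 0)
      by (unfold l; ring).
    apply is_lim_seq_plus'; [apply is_lim_seq_minus'; [apply is_lim_seq_plus'|]|].
    - apply is_lim_seq_const.
    - apply wallis_log.
    - apply is_lim_seq_mult'; [apply is_lim_seq_const|].
      apply (Series_correct _ (proj1 (alt_rem_pos 0 p ltac:(lia)))).
    (* The boundary summand tends to 0; absolute values remove its alternating sign. *)
    - apply is_lim_seq_abs_0.
      apply (is_lim_seq_ext (fun N => Rabs (em_rem 0 (S N * p) - / (2 * INR (S N * p))))).
      { intros N; now rewrite Rabs_mult, pow_1_abs, Rmult_1_l. }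
      apply (proj1 (is_lim_seq_abs_0 _)).
      apply (is_lim_seq_subseq (fun n => em_rem 0 n - / (2 * INR n)) _ (fun N => (S N * p)%nat));
        [apply filterlim_S_mul; lia|].
      apply (is_lim_seq_ext (fun n => em_rem 0 n - / 2 * / INR n)).
      { intros n; now rewrite Rinv_mult. }
      replace 0 with (0 - / 2 * 0) by ring.
      apply is_lim_seq_minus'; [apply em_rem_lim|].
      apply is_lim_seq_mult'; [apply is_lim_seq_const|apply is_lim_seq_inv_INR]. }
  assert (L3 : is_lim_seq (fun N => 2 * INR p * T N) (2 * INR p * l))
    by (apply is_lim_seq_mult'; [apply is_lim_seq_const|exact L2]).
  apply is_lim_seq_unique in L1; apply is_lim_seq_unique in L3.
  rewrite L1 in L3; injection L3; auto.
Qed.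

(** The recursion of [em_rem] is summed over the multiples of [p], where the powers 1/(jp)^(2m + 2)
    add up to eta(2m + 2) / p^(2m + 2). *)
Lemma alt_rem_S m p : (0 < p)%nat ->
  alt_rem (S m) p
  = (-1) ^ m * bern (2 * m + 2) 0 / INR (2 * m + 2) / INR p ^ (2 * m + 2) * eta (2 * m + 2)
    - alt_rem m p.
Proof.
  intros Hp; assert (Pp : 0 < INR p) by (apply lt_0_INR; lia).
  destruct (eta_alternating (2 * m + 2)) as [Ee _]; [lia|].
  unfold alt_rem, eta; rewrite <- Series_scal_l, <- Series_minus.
  - apply Series_ext; intros j; cbn [em_rem].
    rewrite mult_INR, Rpow_mult_distr, Nat.add_1_r.
    assert (INR (2 * m + 2) <> 0) by (apply not_0_INR; lia).
    assert (INR p ^ (2 * m + 2) <> 0) by (apply pow_nonzero; lra).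
    assert (INR (S j) ^ (2 * m + 2) <> 0) by (apply pow_nonzero, not_0_INR; lia).
    field; auto.
  - apply (ex_series_scal (K := R_AbsRing) (V := R_NormedModule)), Ee.
  - apply (proj1 (alt_rem_pos m p Hp)).
Qed.

Theorem proposition11p3 :
  forall B : nat -> R -> R, is_bernoulli_sequence B ->
  let b := fun n : nat => B n 0 in
  forall p m : nat, (2 <= p)%nat -> (1 <= m)%nat ->
  exists eps : R,
    0 < eps < Rabs (b (2 * m)%nat) /\
    PI * cosecant_sum p =
      2 * INR p * ln (INR p)
      + 2 * (euler_gamma - ln (PI / 2)) * INR p
      - sum_n_m (fun k => 2 * b (2 * k)%nat * eta (2 * k)
                          / (INR k * INR p ^ (2 * k - 1))) 1 (m - 1)
      + (-1) ^ m * (2 * eta (2 * m) / (INR m * INR p ^ (2 * m - 1))) * eps.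
Proof.
  intros B HB b p m Hp Hm.
  assert (Eb : forall n, b n = bern n 0)
    by (intros; apply (bernoulli_sequence_unique B HB)).
  clearbody b; clear B HB.
  assert (Pp : 0 < INR p) by (apply lt_0_INR; lia).
  (* From here [m] is one less than in the statement, matching the index shift of [em_rem]. *)
  destruct m as [|m]; [lia|]; clear Hm.
  replace (S m - 1)%nat with m by lia.
  assert (Ppow : forall k, 0 < INR p ^ k) by (intros; apply pow_lt, Pp).
  assert (Ik : forall k, 0 < INR (S k)) by (intros; apply lt_0_INR; lia).
  assert (I2 : forall k, INR (2 * k + 2) = 2 * INR (S k)).
  { intros k; rewrite plus_INR, mult_INR, (S_INR k); simpl; ring. }
  (* The exact expansion at every order; [alt_rem_S] splits one more Bernoulli term off the
     remainder. *)
  assert (Main : forall k, PI * cosecant_sum p =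
      2 * INR p * ln (INR p)
      + 2 * (euler_gamma - ln (PI / 2)) * INR p
      - sum_n_m (fun k => 2 * b (2 * k)%nat * eta (2 * k)
                          / (INR k * INR p ^ (2 * k - 1))) 1 k
      + (-1) ^ S k * (4 * INR p * alt_rem k p)).
  { intros k; induction k as [|k IH].
    - rewrite sum_n_m_zero by lia; rewrite cosecant_sum_alt_rem by exact Hp.
      change (@zero R_AbelianMonoid) with 0; simpl pow; ring.
    - rewrite IH, (sum_n_Sm _ 1 k) by lia; rewrite (alt_rem_S k p) by lia.
      replace (2 * S k - 1)%nat with (2 * k + 1)%nat by lia.
      replace (2 * S k)%nat with (2 * k + 2)%nat by lia.
      rewrite Eb, I2.
      replace (INR p ^ (2 * k + 2)) with (INR p * INR p ^ (2 * k + 1))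
        by (replace (2 * k + 2)%nat with (S (2 * k + 1)) by lia; reflexivity).
      change ((-1) ^ S (S k)) with (-1 * (-1 * (-1) ^ k)).
      change ((-1) ^ S k) with (-1 * (-1) ^ k).
      assert (Sq : (-1) ^ k * (-1) ^ k = 1).
      { rewrite <- pow_add; replace (k + k)%nat with (2 * k)%nat by lia; apply pow_m1_even. }
      specialize (Ppow (2 * k + 1)%nat); specialize (Ik k).
      set (A := sum_n_m _ 1 k).
      set (s := (-1) ^ k) in *; set (P := INR p ^ (2 * k + 1)) in *.
      set (e := eta (2 * k + 2)); set (bk := bern (2 * k + 2) 0).
      set (r := alt_rem k p); set (i := INR (S k)) in *.
      change (plus A (2 * bk * e / (i * P))) with (A + 2 * bk * e / (i * P)).
      clearbody A s P e bk r i.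
      replace (-1 * (-1 * s) * (4 * INR p * (s * bk / (2 * i) / (INR p * P) * e - r)))
        with ((s * s) * (2 * bk * e / (i * P)) - s * (4 * INR p * r)) by (field; lra).
      rewrite Sq; ring. }
  (* Positivity at this level gives [0 < eps]; at the next level it gives
     [eps < (-1) ^ m * b (2 * m + 2)], which is at most the absolute value. *)
  assert (R0 := proj2 (alt_rem_pos m p ltac:(lia))).
  assert (R1 := proj2 (alt_rem_pos (S m) p ltac:(lia))).
  rewrite alt_rem_S in R1 by lia.
  destruct (eta_alternating (2 * m + 2)) as [_ Ee]; [lia|].
  rewrite I2 in R1.
  replace (2 * S m - 1)%nat with (2 * m + 1)%nat by lia.
  replace (2 * S m)%nat with (2 * m + 2)%nat by lia.
  assert (Pe : INR p ^ (2 * m + 2) = INR p * INR p ^ (2 * m + 1))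
    by (replace (2 * m + 2)%nat with (S (2 * m + 1)) by lia; reflexivity).
  rewrite Pe in R1.
  specialize (Ppow (2 * m + 1)%nat); specialize (Ik m).
  (* This value solves [4 * INR p * alt_rem m p = 2 * eta (2 * m + 2) / (INR (S m) * INR p ^ (2 * m
     + 1)) * eps]. *)
  exists (2 * INR (S m) * (INR p * INR p ^ (2 * m + 1)) * alt_rem m p / eta (2 * m + 2)).
  split; [split|].
  - apply Rdiv_lt_0_compat; [|exact Ee].
    repeat apply Rmult_lt_0_compat; lra.
  - apply Rlt_le_trans with ((-1) ^ m * b (2 * m + 2)%nat).
    + rewrite Eb; apply Rlt_div_l; [exact Ee|].
      set (s := (-1) ^ m) in *; set (P := INR p ^ (2 * m + 1)) in *.
      set (e := eta (2 * m + 2)) in *; set (bk := bern (2 * m + 2) 0) in *.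
      set (r := alt_rem m p) in *; set (i := INR (S m)) in *.
      replace (s * bk * e) with (2 * i * (INR p * P) * (s * bk / (2 * i) / (INR p * P) * e))
        by (field; lra).
      apply Rmult_lt_compat_l; [|lra].
      repeat apply Rmult_lt_0_compat; lra.
    + eapply Rle_trans; [apply Rle_abs|].
      rewrite Rabs_mult, pow_1_abs; lra.
  - rewrite (Main m).
    set (s := (-1) ^ S m) in *; set (P := INR p ^ (2 * m + 1)) in *.
    field; lra.
Qed.
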